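(* Let $a,b\in\mathbb{R}$, $\tau>0$, $T=N\tau$ with $N\in\mathbb{N}$, $N\ge 1$, and let $f\in C([0,T],\mathbb{R})$. Consider the problem $$\ddot y(t)=a\,y(t)+b\,y(t-\tau)+f(t),\quad t\in[0,T],\qquad y(t)=0,\ \ \dot y(t)=0,\quad t\in[-\tau,0].$$ Then its stepwise classical solution $y_p$ is given, for $t\in[0,T]$, by $$y_p(t)=\int_{0}^{t} S_{\tau}^{a,b}(t-s)\,f(s)\,ds.$$
   Context: Write $(t)_+:=\max\{0,t\}$ and use the convention $0^0=1$. For $a,b\in\mathbb{R}$ and $\tau>0$, the delayed perturbation function $S_{\tau}^{a,b}$ is defined for $t\ge 0$ by the absolutely convergent series $$S_{\tau}^{a,b}(t):=\sum_{k=0}^{\infty}\sum_{m=k}^{\infty}\binom{m}{k}a^{m-k}b^{k}\frac{(t-k\tau)_{+}^{2m+1}}{(2m+1)!},$$ and is extended by zero to negative arguments. A function $y:[-\tau,T]\to\mathbb{R}$ is a stepwise (classical) solution of the problem $\ddot y(t)=a\,y(t)+b\,y(t-\tau)+f(t)$ on $[0,T]$ with history $\varphi$ (here with $\varphi\equiv 0$) if: (i) $y,\dot y\in C([-\tau,T])$; (ii) for each $k=1,\dots,N$, $\ddot y$ exists and is continuous on $((k-1)\tau,k\tau)$ and admits a continuous extension to $[(k-1)\tau,k\tau]$ (so $\ddot y$ may jump at $t=k\tau$); (iii) the equation holds pointwise for all $t\in((k-1)\tau,k\tau)$, $k=1,\dots,N$; (iv) $y(t)=\varphi(t)$ and $\dot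 y(t)=\dot\varphi(t)$ for all $t\in[-\tau,0]$. *)

(* Defs.v *)
(* Stdlib real numbers with Coquelicot. *)
From Stdlib Require Import Reals Factorial Lra Lia.
From Coquelicot Require Import Coquelicot.
Open Scope R_scope.

Definition pos_part (t : R) : R := Rmax 0 t.

(* [Binomial.C] is the binomial coefficient ([C] alone is Coquelicot's type of
   complex numbers).  [pow x 0 = 1] for every [x], hence 0^0 = 1. *)
Definition dpf_term (a b tau t : R) (k m : nat) : R :=
  Binomial.C m k * a ^ (m - k) * b ^ k *
  (pos_part (t - INR k * tau) ^ (2 * m + 1) / INR (fact (2 * m + 1))).

(* The inner sum over m >= k is indexed by j = m - k.  [Series] is a total
   operator; the absolute convergence of the double series is
   [dpf_term_abs_convergent]. *)
Definition dpf (a b tau t : R) : R :=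
  if Rlt_dec t 0 then 0
  else Series (fun k => Series (fun j => dpf_term a b tau t k (k + j))).

Definition Icc (l u : R) : R -> Prop := fun t => l <= t <= u.
Definition Ioo (l u : R) : R -> Prop := fun t => l < t < u.

(* Stepwise classical solution on [-tau, N tau] of
     y''(t) = a y(t) + b y(t - tau) + f(t),   y = phi on [-tau, 0].
   Functions are total on R; only values on [-tau, N tau] (for [f] on
   [0, N tau], for [phi] on [-tau, 0]) are constrained.
   [dy] and [ddy] are y' and y''; [D_in g g' D t] is the derivative at t along D,
   so y' is one-sided at the end points.  The last conjunct says that y' = phi'
   on [-tau, 0]. *)
Definition stepwise_solution
    (a b tau : R) (N : nat) (f phi y : R -> R) : Prop :=
  let T := INR N * tau in
  exists dy ddy : R -> R,
    (continuous_on (Icc (- tau) T) y /\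
     (forall t, Icc (- tau) T t -> D_in y dy (Icc (- tau) T) t) /\
     continuous_on (Icc (- tau) T) dy) /\
    (forall k : nat, (1 <= k <= N)%nat ->
       let l := (INR k - 1) * tau in
       let u := INR k * tau in
       (forall t, Ioo l u t -> is_derive dy t (ddy t)) /\
       continuous_on (Ioo l u) ddy /\
       (exists g : R -> R,
          continuous_on (Icc l u) g /\ (forall t, Ioo l u t -> g t = ddy t)) /\
       (forall t, Ioo l u t -> ddy t = a * y t + b * y (t - tau) + f t)) /\
    (forall t, Icc (- tau) 0 t ->
       y t = phi t /\ D_in phi dy (Icc (- tau) 0) t).

Lemma dpf_term_bound (a b tau t : R) (k j : nat) :
  0 < tau -> 0 <= t ->
  Rabs (dpf_term a b tau t k (k + j)) <=
  t * (/ INR (fact k) * (Rabs b * t ^ 2) ^ k) *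
  (/ INR (fact j) * (Rabs a * t ^ 2) ^ j).
Proof.
intros Htau Ht; unfold dpf_term, Binomial.C.
replace (k + j - k)%nat with j by lia.
set (p := pos_part (t - INR k * tau)).
assert (Hp : 0 <= p <= t).
{ unfold p, pos_part; split; [apply Rmax_l|].
  apply Rmax_lub; [lra|].
  assert (0 <= INR k * tau) by (apply Rmult_le_pos; [apply pos_INR|lra]); lra. }
pose proof (INR_fact_lt_0 k) as Hk; pose proof (INR_fact_lt_0 j) as Hj.
pose proof (INR_fact_lt_0 (k + j)) as Hkj.
pose proof (INR_fact_lt_0 (2 * (k + j) + 1)) as Hm.
assert (Hf : INR (fact (k + j)) <= INR (fact (2 * (k + j) + 1)))
  by (apply le_INR, fact_le; lia).
assert (Hpow : 0 <= p ^ (2 * (k + j) + 1) <= t ^ (2 * (k + j) + 1))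
  by (split; [apply pow_le; lra | apply pow_incr; lra]).
rewrite !Rabs_mult, <- !RPow_abs.
rewrite (Rabs_pos_eq (_ / (_ * _)))
  by (apply Rlt_le, Rdiv_lt_0_compat; [|apply Rmult_lt_0_compat]; assumption).
rewrite (Rabs_pos_eq (_ / _))
  by (apply Rmult_le_pos; [|apply Rlt_le, Rinv_0_lt_compat]; lra).
assert (Hq : 0 <= INR (fact (k + j)) / INR (fact (2 * (k + j) + 1)) <= 1).
{ split; [apply Rlt_le, Rdiv_lt_0_compat; assumption|].
  apply (Rmult_le_reg_r (INR (fact (2 * (k + j) + 1)))); [assumption|].
  unfold Rdiv; rewrite Rmult_assoc, Rinv_l; lra. }
set (c := / INR (fact k) * / INR (fact j) * Rabs a ^ j * Rabs b ^ k).
assert (Hc : 0 <= c).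
{ unfold c; repeat apply Rmult_le_pos;
    try (apply Rlt_le, Rinv_0_lt_compat; assumption);
    apply pow_le, Rabs_pos. }
replace (_ * _) with (c * (INR (fact (k + j)) / INR (fact (2 * (k + j) + 1))
                           * p ^ (2 * (k + j) + 1)))
  by (unfold c; field; lra).
replace (t * _ * _) with (c * t ^ (2 * (k + j) + 1)).
2: { unfold c; rewrite !Rpow_mult_distr, <- !pow_mult.
     replace (2 * (k + j) + 1)%nat with (S (2 * k + 2 * j)) by lia.
     rewrite <- tech_pow_Rmult, pow_add; ring. }
apply Rmult_le_compat_l; [assumption|].
apply Rle_trans with (1 * p ^ (2 * (k + j) + 1)); [|lra].
apply Rmult_le_compat_r; lra.
Qed.

Lemma dpf_exp_series (x : R) : is_series (fun n => / INR (fact n) * x ^ n) (exp x).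
Proof.
apply is_pseries_R, is_exp_Reals.
Qed.

Lemma dpf_term_abs_convergent (a b tau t : R) :
  0 < tau -> 0 <= t ->
  (forall k, ex_series (fun j => Rabs (dpf_term a b tau t k (k + j)))) /\
  ex_series (fun k => Series (fun j => Rabs (dpf_term a b tau t k (k + j)))).
Proof.
intros Htau Ht.
pose (A := fun j : nat => / INR (fact j) * (Rabs a * t ^ 2) ^ j).
pose (B := fun k : nat => / INR (fact k) * (Rabs b * t ^ 2) ^ k).
assert (HA : ex_series A) by (eexists; apply dpf_exp_series).
assert (HB : ex_series B) by (eexists; apply dpf_exp_series).
assert (HAk : forall k, ex_series (fun j => t * B k * A j))
  by (intro k; apply (ex_series_scal_l (t * B k) A HA)).
assert (H : forall k j,
  0 <= Rabs (dpf_term a b tau t k (k + j)) <= t * B k * A j)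
  by (intros k j; split; [apply Rabs_pos | apply dpf_term_bound; assumption]).
assert (H1 : forall k, ex_series (fun j => Rabs (dpf_term a b tau t k (k + j)))).
{ intro k; apply (@ex_series_le R_AbsRing R_CompleteNormedModule _ (fun j => t * B k * A j)); [|apply HAk].
  intro j; unfold norm; simpl; unfold abs; simpl.
  rewrite Rabs_Rabsolu; apply H. }
split; [exact H1|].
apply (@ex_series_le R_AbsRing R_CompleteNormedModule _ (fun k => t * Series A * B k));
  [|apply (ex_series_scal_l (t * Series A) B HB)].
intro k; unfold norm; simpl; unfold abs; simpl.
rewrite Rabs_pos_eq.
- replace (t * Series A * B k) with (Series (fun j => t * B k * A j))
    by (rewrite Series_scal_l; ring).
  apply Series_le; [apply H | apply HAk].
- apply Rle_trans with (Series (fun j => 0 * A j)).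
  + rewrite Series_scal_l; lra.
  + apply Series_le; [|apply H1].
    intro j; rewrite Rmult_0_l; split; [lra | apply Rabs_pos].
Qed.

(* Main.v *)
Require Import Defs.
From Stdlib Require Import Reals Factorial Lra Lia.
From Coquelicot Require Import Coquelicot.
Open Scope R_scope.

(** Group the double series for S by the delay index k: S is the sum over k of
b^k G_k((t - k tau)_+), where G_k is an entire function ([mode a k]) that does
not depend on b or tau.  Pascal's rule turns the binomial coefficients into the
chain of equations
  G_k'' = a G_k + G_(k-1),  G_(-1) = 0,  G_k(0) = 0,  G_k'(0) = 1 if k = 0, else 0,
and for t <= n tau only the terms k <= n survive, so S is there a finite sum
([dpf_modes]); no differentiation of a double series is needed.

Extend f continuously to F on the whole line and let H_k be the integral of
G_k(t - s) F(s) over s in [0, t].  Differentiating twice under the integral sign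
gives H_k'' = a H_k + H_(k-1), plus F when k = 0 ([is_derive_conv_dmode]).  Since
H_k and H_k' vanish at 0, the truncation t |-> H_k((t - k tau)_+) is C^1 on the
line; for k >= 1 also H_k''(0) = 0, so y(t) = sum over k <= N of
b^k H_k((t - k tau)_+) is differentiable twice for t > 0.  Reindexing the
H_(k-1) terms produces b y(t - tau), hence y solves the problem
([stepwise_solution_delay_sum]).  On the other hand the integral of S(t - s) F(s),
taken term by term in the finite sum, is y(t) as well ([is_RInt_dpf_conv]).

Uniqueness ([stepwise_solution_unique]) is the method of steps: once two solutions
agree up to (k-1) tau, their difference z satisfies z'' = a z on the next step with
zero initial data, and a weighted energy forces z = 0 ([linear_ode2_zero]). *)

(** * Entire functions from factorially bounded coefficients and the modes G_k *)

(** If |c_n| <= K M^n / n!, then c_n r^n is bounded for every r, since (M r)^n / n!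
is the general term of the convergent exponential series. *)
Lemma CV_radius_exp_type (c : nat -> R) (K M : R) :
  (forall n, Rabs (c n) <= K * (M ^ n / INR (fact n))) ->
  forall x, Rbar_lt (Rabs x) (CV_radius c).
Proof.
intros Hc x.
apply Rbar_lt_le_trans with (Rabs x + 1); [simpl; lra|].
set (r := Rabs x + 1).
assert (Hr : 0 <= r) by (unfold r; pose proof (Rabs_pos x); lra).
apply (CV_radius_bounded c).
destruct (filterlim_bounded (fun n => / INR (fact n) * (M * r) ^ n)) as [B HB].
{ exists 0. apply (ex_series_lim_0 (fun n => / INR (fact n) * (M * r) ^ n)).
  eexists; apply dpf_exp_series. }
exists (Rabs K * B); intro n.
rewrite Rabs_mult, (Rabs_pos_eq (r ^ n)) by (apply pow_le; assumption).
apply Rle_trans with (K * (M ^ n / INR (fact n)) * r ^ n).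
{ apply Rmult_le_compat_r; [apply pow_le; assumption | apply Hc]. }
replace (K * (M ^ n / INR (fact n)) * r ^ n)
  with (K * (/ INR (fact n) * (M * r) ^ n))
  by (rewrite Rpow_mult_distr; unfold Rdiv; ring).
apply Rle_trans with (1 := Rle_abs _).
rewrite Rabs_mult; apply Rmult_le_compat_l; [apply Rabs_pos | apply HB].
Qed.

Definition shift (u : nat -> R) (k : nat) : R :=
  match k with O => 0 | S k' => u k' end.

(** Taylor coefficients at 0 of G_k, defined by the recursion that
G_k'' = a G_k + G_(k-1) imposes on them.  This makes the differential equation
immediate; the binomial closed form is recovered in [mode_coef_odd]. *)
Fixpoint mode_coef (a : R) (n k : nat) {struct n} : R :=
  match n with
  | O => 0
  | S O => match k with O => 1 | S _ => 0 end
  | S (S m) =>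
      (a * mode_coef a m k + shift (mode_coef a m) k) / (INR (S m) * INR (S (S m)))
  end.

Lemma mode_coef_SS (a : R) (n k : nat) :
  mode_coef a (S (S n)) k =
  (a * mode_coef a n k + shift (mode_coef a n) k) / (INR (S n) * INR (S (S n))).
Proof. reflexivity. Qed.

(** Up to the factorials, one step of the recursion multiplies the bound by
|a| + 1 <= (1 + |a|)^2.  It relates indices two apart, whence an induction on two
consecutive bounds. *)
Lemma mode_coef_bound (a : R) (n k : nat) :
  Rabs (mode_coef a n k) <= 1 * ((1 + Rabs a) ^ n / INR (fact n)).
Proof.
rewrite Rmult_1_l.
set (M := 1 + Rabs a).
assert (HM : 1 <= M) by (unfold M; pose proof (Rabs_pos a); lra).
enough (H : forall m,
  (forall k, Rabs (mode_coef a m k) <= M ^ m / INR (fact m)) /\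
  (forall k, Rabs (mode_coef a (S m) k) <= M ^ S m / INR (fact (S m))))
  by apply H.
clear n k; intro n; induction n as [|n [IH0 IH1]].
- split; intro k; simpl.
  + rewrite Rabs_R0; lra.
  + destruct k; rewrite ?Rabs_R0, ?Rabs_R1; lra.
- split; [exact IH1|]; intro k.
  assert (Hn := INR_fact_lt_0 n).
  set (e := M ^ n / INR (fact n)).
  assert (He : 0 <= e).
  { apply Rmult_le_pos; [apply pow_le; lra|].
    apply Rlt_le, Rinv_0_lt_compat; assumption. }
  assert (Hp : 0 < INR (S n) * INR (S (S n)))
    by (apply Rmult_lt_0_compat; apply lt_0_INR; lia).
  assert (Hs : Rabs (shift (mode_coef a n) k) <= e)
    by (destruct k; simpl; [rewrite Rabs_R0; exact He | apply IH0]).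
  rewrite mode_coef_SS; unfold Rdiv; rewrite Rabs_mult.
  rewrite (Rabs_pos_eq (/ _)) by (apply Rlt_le, Rinv_0_lt_compat; assumption).
  replace (M ^ S (S n) * / INR (fact (S (S n))))
    with (M * M * e * / (INR (S n) * INR (S (S n)))).
  2:{ unfold e; rewrite !fact_simpl, !mult_INR; simpl pow; field.
      repeat split; try (apply not_0_INR; lia); lra. }
  apply Rmult_le_compat_r; [apply Rlt_le, Rinv_0_lt_compat; assumption|].
  apply Rle_trans with (1 := Rabs_triang _ _).
  rewrite Rabs_mult.
  apply Rle_trans with (Rabs a * e + e).
  + apply Rplus_le_compat; [|exact Hs].
    apply Rmult_le_compat_l; [apply Rabs_pos | apply IH0].
  + replace (Rabs a * e + e) with (1 * (M * e)) by (unfold M; ring).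
    rewrite (Rmult_assoc M M e).
    apply Rmult_le_compat_r; [apply Rmult_le_pos; lra | exact HM].
Qed.

Definition mode (a : R) (k : nat) : R -> R := PSeries (fun n => mode_coef a n k).

Definition dmode (a : R) (k : nat) : R -> R :=
  PSeries (PS_derive (fun n => mode_coef a n k)).

Lemma mode_radius (a : R) (k : nat) (x : R) :
  Rbar_lt (Rabs x) (CV_radius (fun n => mode_coef a n k)).
Proof.
apply CV_radius_exp_type with (K := 1) (M := 1 + Rabs a).
intro n; apply mode_coef_bound.
Qed.

Lemma is_derive_mode (a : R) (k : nat) (t : R) :
  is_derive (mode a k) t (dmode a k t).
Proof. apply is_derive_PSeries, mode_radius. Qed.

(** The equation G_k'' = a G_k + G_(k-1), coefficient by coefficient. *)
Lemma is_derive_dmode (a : R) (k : nat) (t : R) :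
  is_derive (dmode a k) t (a * mode a k t + shift (fun i => mode a i t) k).
Proof.
set (c := fun n => mode_coef a n k).
replace (a * mode a k t + shift (fun i => mode a i t) k)
  with (PSeries (PS_derive (PS_derive c)) t).
- apply is_derive_PSeries; rewrite CV_radius_derive; apply mode_radius.
- transitivity
    (PSeries (PS_plus (PS_scal a c) (fun n => shift (mode_coef a n) k)) t).
  + apply PSeries_ext; intro n; unfold PS_plus, PS_derive, c.
    rewrite mode_coef_SS; change (PS_scal a _ n) with (a * mode_coef a n k).
    change (plus ?x ?y) with (x + y).
    field; split; apply not_0_INR; lia.
  + rewrite PSeries_plus.
    * rewrite PSeries_scal; f_equal.
      destruct k as [|k]; simpl; [apply PSeries_const_0 | reflexivity].
    * apply ex_pseries_scal; [apply Rmult_comm | apply CV_radius_inside, mode_radius].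
    * destruct k as [|k]; simpl; [|apply CV_radius_inside, mode_radius].
      apply CV_radius_inside; rewrite CV_radius_const_0; exact I.
Qed.

Lemma mode_0 (a : R) (k : nat) : mode a k 0 = 0.
Proof. unfold mode; rewrite PSeries_0; reflexivity. Qed.

Lemma dmode_0 (a : R) (k : nat) :
  dmode a k 0 = match k with O => 1 | S _ => 0 end.
Proof.
unfold dmode; rewrite PSeries_0; unfold PS_derive; simpl; destruct k; ring.
Qed.

Lemma continuous_mode (a : R) (k : nat) (t : R) : continuous (mode a k) t.
Proof. apply (ex_derive_continuous (mode a k)); eexists; apply is_derive_mode. Qed.

Lemma continuous_dmode (a : R) (k : nat) (t : R) : continuous (dmode a k) t.
Proof. apply (ex_derive_continuous (dmode a k)); eexists; apply is_derive_dmode. Qed.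

(** * The delayed perturbation function as a finite sum of modes *)

Lemma mode_coef_even (a : R) (m k : nat) : mode_coef a (2 * m) k = 0.
Proof.
revert k; induction m as [|m IH]; intro k; [reflexivity|].
replace (2 * S m)%nat with (S (S (2 * m))) by lia.
rewrite mode_coef_SS, IH.
replace (shift (mode_coef a (2 * m)) k) with 0 by (destruct k; simpl; auto).
unfold Rdiv; ring.
Qed.

Lemma mode_coef_odd_lt (a : R) (m k : nat) :
  (m < k)%nat -> mode_coef a (2 * m + 1) k = 0.
Proof.
revert k; induction m as [|m IH]; intros k Hk.
- destruct k; [lia | reflexivity].
- replace (2 * S m + 1)%nat with (S (S (2 * m + 1))) by lia.
  rewrite mode_coef_SS, IH by lia.
  destruct k as [|k]; [lia|]; unfold shift; rewrite IH by lia.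
  unfold Rdiv; ring.
Qed.

(** The recursion is Pascal's rule.  On the diagonal its out-of-range term is treated
apart, because [Binomial.C m k] does not vanish for m < k. *)
Lemma mode_coef_odd (a : R) (m k : nat) :
  (k <= m)%nat ->
  mode_coef a (2 * m + 1) k =
  Binomial.C m k * a ^ (m - k) / INR (fact (2 * m + 1)).
Proof.
revert k; induction m as [|m IH]; intros k Hk.
- replace k with 0%nat by lia; rewrite C_n_0; simpl; field.
- replace (2 * S m + 1)%nat with (S (S (2 * m + 1))) by lia.
  rewrite mode_coef_SS, !fact_simpl, !mult_INR.
  assert (Hf := INR_fact_lt_0 (2 * m + 1)).
  assert (H1 : INR (S (2 * m + 1)) <> 0) by (apply not_0_INR; lia).
  assert (H2 : INR (S (S (2 * m + 1))) <> 0) by (apply not_0_INR; lia).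
  destruct k as [|k]; unfold shift.
  + rewrite IH, !C_n_0, !Nat.sub_0_r by lia; simpl pow; field; lra.
  + rewrite (IH k) by lia.
    replace (S m - S k)%nat with (m - k)%nat by lia.
    destruct (Nat.eq_dec k m) as [->|Hne].
    * rewrite mode_coef_odd_lt, !C_n_n by lia; field; lra.
    * rewrite (IH (S k)), <- pascal by lia.
      replace (m - k)%nat with (S (m - S k)) by lia; simpl pow; field; lra.
Qed.

(** The inner series of [dpf_term] with the factor b^k removed and an arbitrary
argument: the even coefficients and the odd ones of rank m < k are zero. *)
Lemma mode_series (a : R) (k : nat) (t : R) :
  mode a k t =
  Series (fun j => Binomial.C (k + j) k * a ^ (k + j - k) *
                   (t ^ (2 * (k + j) + 1) / INR (fact (2 * (k + j) + 1)))).
Proof.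
unfold mode; rewrite PSeries_odd_even.
- rewrite (PSeries_ext _ (fun _ => 0)) by (intro; apply mode_coef_even).
  rewrite PSeries_const_0, Rplus_0_l; unfold PSeries.
  rewrite <- Series_scal_l, (Series_incr_n_aux _ k).
  + apply Series_ext; intro j.
    rewrite mode_coef_odd by lia.
    rewrite <- pow_mult, (pow_add t (2 * (k + j)) 1); simpl (t ^ 1).
    unfold Rdiv; ring.
  + intros m Hm; rewrite mode_coef_odd_lt by exact Hm; ring.
- apply CV_radius_inside, (CV_radius_exp_type _ 0 1); intro n.
  rewrite mode_coef_even, Rabs_R0; lra.
- apply CV_radius_inside,
    (CV_radius_exp_type _ (1 + Rabs a) ((1 + Rabs a) ^ 2)); intro n.
  apply Rle_trans with (1 := mode_coef_bound _ _ _).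
  assert (HM : 0 <= 1 + Rabs a) by (pose proof (Rabs_pos a); lra).
  rewrite Rmult_1_l, <- pow_mult, pow_add, pow_1, (Rmult_comm (_ ^ _)).
  unfold Rdiv; rewrite Rmult_assoc.
  apply Rmult_le_compat_l; [exact HM|].
  apply Rmult_le_compat_l; [apply pow_le; exact HM|].
  apply Rinv_le_contravar; [apply INR_fact_lt_0 | apply le_INR, fact_le; lia].
Qed.

Lemma Series_finite (u : nat -> R) (n : nat) :
  (forall k, (n < k)%nat -> u k = 0) -> Series u = sum_n u n.
Proof.
intro Hu; apply is_series_unique.
apply (is_series_decr_n u (S n)); [lia|].
apply is_series_ext with (fun _ => 0).
{ intro j; symmetry; apply Hu; lia. }
simpl pred; change (is_series (fun _ : nat => 0) (sum_n u n + - sum_n u n)).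
rewrite Rplus_opp_r.
apply (filterlim_ext (fun _ : nat => 0)); [|apply filterlim_const].
intro m; rewrite sum_n_const; ring.
Qed.

Lemma pos_part_nonneg (t : R) : 0 <= t -> pos_part t = t.
Proof. apply Rmax_right. Qed.

Lemma pos_part_nonpos (t : R) : t <= 0 -> pos_part t = 0.
Proof. apply Rmax_left. Qed.

(** For k > n the truncated argument is 0, where every G_k vanishes. *)
Lemma dpf_modes (a b tau t : R) (n : nat) :
  0 < tau -> 0 <= t -> t <= INR n * tau ->
  dpf a b tau t =
  sum_n (fun k => b ^ k * mode a k (pos_part (t - INR k * tau))) n.
Proof.
intros Htau Ht Hn; unfold dpf; destruct (Rlt_dec t 0) as [|_]; [lra|].
rewrite <- Series_finite.
- apply Series_ext; intro k; rewrite mode_series, <- Series_scal_l.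
  apply Series_ext; intro j; unfold dpf_term; ring.
- intros k Hk; rewrite pos_part_nonpos, mode_0; [ring|].
  assert (INR n * tau <= INR k * tau)
    by (apply Rmult_le_compat_r; [lra | apply le_INR; lia]).
  lra.
Qed.

(** * Convolution with a continuous forcing *)

Definition conv (g F : R -> R) (t : R) : R :=
  RInt (fun s => g (t - s) * F s) 0 t.

Lemma continuous_conv_integrand (g F : R -> R) (t : R) :
  (forall x, continuous g x) -> (forall x, continuous F x) ->
  forall s, continuous (fun s => g (t - s) * F s) s.
Proof.
intros Hg HF s.
apply (continuous_mult (fun s => g (t - s)) F); [|apply HF].
apply (continuous_comp (fun s => t - s) g); [|apply Hg].
apply (continuous_minus (fun _ => t) (fun s => s)).
- apply continuous_const.
- apply continuous_id.
Qed.

Lemma ex_RInt_conv (g F : R -> R) (t u v : R) :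
  (forall x, continuous g x) -> (forall x, continuous F x) ->
  ex_RInt (fun s => g (t - s) * F s) u v.
Proof.
intros Hg HF; apply (ex_RInt_continuous (V := R_CompleteNormedModule)).
intros s _; apply continuous_conv_integrand; assumption.
Qed.

Lemma conv_0 (g F : R -> R) : conv g F 0 = 0.
Proof. apply (RInt_point (V := R_CompleteNormedModule)). Qed.

(** Leibniz' rule: the moving end point contributes g(0) F(t). *)
Lemma is_derive_conv (g dg F : R -> R) (t : R) :
  (forall x, is_derive g x (dg x)) -> (forall x, continuous dg x) ->
  (forall x, continuous F x) ->
  is_derive (conv g F) t (g 0 * F t + conv dg F t).
Proof.
intros Hg Hdg HF.
assert (Cg : forall x, continuous g x).
{ intro x; apply (ex_derive_continuous g); eexists; apply Hg. }
assert (HD : forall u s,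
  is_derive (fun z => g (z - s) * F s) u (dg (u - s) * F s)).
{ intros u s; apply (is_derive_ext (fun z => F s * g (z - s)));
    [intro; apply Rmult_comm|].
  rewrite Rmult_comm; apply is_derive_scal.
  replace (dg (u - s)) with (scal 1 (dg (u - s))) by (apply Rmult_1_l).
  apply (is_derive_comp g (fun z => z - s)); [apply Hg|].
  auto_derive; [exact I | ring]. }
(* The partial derivative in the outer variable is jointly continuous, being a
   product of continuous functions of u - s and of s. *)
assert (C2 : forall u s, continuity_2d_pt
  (fun u s => Derive (fun z => g (z - s) * F s) u) u s).
{ intros u s.
  apply (continuity_2d_pt_ext (fun u s => dg (u - s) * F s)).
  { intros u' s'; symmetry; apply is_derive_unique, HD. }
  apply continuity_2d_pt_mult.
  - apply (continuity_1d_2d_pt_comp dg (fun u s => u - s)).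
    + apply continuity_pt_filterlim, Hdg.
    + apply continuity_2d_pt_minus;
        [apply continuity_2d_pt_id1 | apply continuity_2d_pt_id2].
  - apply (continuity_1d_2d_pt_comp F (fun u s => s)).
    + apply continuity_pt_filterlim, HF.
    + apply continuity_2d_pt_id2. }
(* The summand g (t - t) * F t * 1 has the form in which Leibniz' rule delivers the
   boundary term. *)
replace (g 0 * F t + conv dg F t)
  with (RInt (fun s => Derive (fun z => g (z - s) * F s) t) 0 t
        + g (t - t) * F t * 1).
- apply (is_derive_RInt_param_bound_comp_aux3
           (fun z s => g (z - s) * F s) 0 (fun z => z) t 1).
  + apply filter_forall; intro; apply ex_RInt_conv; assumption.
  + exists posreal_one; apply filter_forall; intro; apply ex_RInt_conv; assumption.
  + apply (is_derive_id (K := R_AbsRing)).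
  + exists posreal_one; apply filter_forall; intros u s _; eexists; apply HD.
  + intros s _; apply C2.
  + exists posreal_one; intros u v _ _; apply C2.
  + apply continuity_pt_filterlim, (continuous_conv_integrand g F t); assumption.
- rewrite Rminus_diag, Rmult_1_r, Rplus_comm; f_equal.
  apply RInt_ext; intros s _; apply is_derive_unique, HD.
Qed.

(** There is no boundary term because G_k(0) = 0. *)
Lemma is_derive_conv_mode (a : R) (F : R -> R) (k : nat) (t : R) :
  (forall x, continuous F x) ->
  is_derive (conv (mode a k) F) t (conv (dmode a k) F t).
Proof.
intro HF; replace (conv (dmode a k) F t)
  with (mode a k 0 * F t + conv (dmode a k) F t) by (rewrite mode_0; ring).
apply is_derive_conv; [apply is_derive_mode | apply continuous_dmode | exact HF].
Qed.

Lemma is_RInt_zero (u v : R) : is_RInt (fun _ => 0) u v 0.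
Proof.
assert (H := is_RInt_const (V := R_NormedModule) u v 0).
change (is_RInt (fun _ => 0) u v ((v - u) * 0)) in H.
rewrite Rmult_0_r in H; exact H.
Qed.

Lemma continuous_shift (u : nat -> R -> R) (k : nat) (t : R) :
  (forall i, continuous (u i) t) -> continuous (fun x => shift (fun i => u i x) k) t.
Proof. intro Hu; destruct k; simpl; [apply continuous_const | apply Hu]. Qed.

(** The boundary term G_k'(0) F(t) is where the forcing enters, for k = 0 only. *)
Lemma is_derive_conv_dmode (a : R) (F : R -> R) (k : nat) (t : R) :
  (forall x, continuous F x) ->
  is_derive (conv (dmode a k) F) t
    (a * conv (mode a k) F t + shift (fun i => conv (mode a i) F t) k
     + match k with O => F t | S _ => 0 end).
Proof.
intro HF.
set (ddm := fun x => a * mode a k x + shift (fun i => mode a i x) k).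
replace (_ + _ + _) with (dmode a k 0 * F t + conv ddm F t).
- apply is_derive_conv; [apply is_derive_dmode | | exact HF].
  intro x; apply (continuous_plus (fun x => a * mode a k x)
                    (fun x => shift (fun i => mode a i x) k)).
  + apply (continuous_scal_r a (mode a k)), continuous_mode.
  + apply continuous_shift; intro; apply continuous_mode.
- assert (H : is_RInt (fun s => ddm (t - s) * F s) 0 t
                (a * conv (mode a k) F t + shift (fun i => conv (mode a i) F t) k)).
  { apply (is_RInt_ext (fun s => plus (scal a (mode a k (t - s) * F s))
             (shift (fun i => mode a i (t - s) * F s) k))).
    { intros s _; unfold ddm, plus, scal; simpl; unfold mult; simpl.
      destruct k; simpl; ring. }
    assert (HI : forall i, is_RInt (fun s => mode a i (t - s) * F s) 0 t
                             (conv (mode a i) F t)).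
    { intro i; apply (RInt_correct (V := R_CompleteNormedModule)), ex_RInt_conv;
        [apply continuous_mode | exact HF]. }
    apply (is_RInt_plus (V := R_NormedModule)).
    - apply (is_RInt_scal (V := R_NormedModule)), HI.
    - destruct k; simpl; [|apply HI].
      apply is_RInt_zero. }
  unfold conv at 1; rewrite (is_RInt_unique _ _ _ _ H), dmode_0.
  destruct k; ring.
Qed.

(** * Sums of delayed truncated functions *)

Lemma continuous_pos_part (t : R) : continuous pos_part t.
Proof.
intros P [d Hd]; exists d; intros x Hx; apply Hd.
apply Rle_lt_trans with (2 := Hx).
change (Rabs (pos_part x - pos_part t) <= Rabs (x - t)).
unfold pos_part, Rmax; repeat destruct Rle_dec;
  unfold Rabs; repeat destruct Rcase_abs; lra.
Qed.

(** Composing with the positive part creates a corner at 0 only, and the corner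
disappears when h'(0) = 0. *)
Lemma is_derive_comp_pos_part (h dh : R -> R) (t : R) :
  (forall x, is_derive h x (dh x)) -> dh 0 = 0 \/ 0 < t ->
  is_derive (fun x => h (pos_part x)) t (dh (pos_part t)).
Proof.
intros Hh H0; destruct (Rlt_le_dec 0 t) as [Ht|Ht].
{ rewrite pos_part_nonneg by lra.
  apply (is_derive_ext_loc h); [|apply Hh].
  apply (filter_imp (fun x => 0 < x)); [|apply (open_gt 0); exact Ht].
  intros x Hx; rewrite pos_part_nonneg; [reflexivity | lra]. }
destruct H0 as [H0|]; [|lra].
rewrite pos_part_nonpos by exact Ht.
destruct Ht as [Ht| ->].
- rewrite H0; apply (is_derive_ext_loc (fun _ => h 0));
    [|apply (is_derive_const (V := R_NormedModule))].
  apply (filter_imp (fun x => x < 0)); [|apply (open_lt 0); exact Ht].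
  intros x Hx; rewrite pos_part_nonpos; [reflexivity | lra].
- apply is_derive_Reals; intros eps Heps.
  destruct (proj1 (is_derive_Reals h 0 (dh 0)) (Hh 0) eps Heps) as [d Hd].
  exists d; intros x Hx Hxd; rewrite (pos_part_nonpos 0), Rplus_0_l by lra.
  destruct (Rle_dec 0 x) as [Hp|Hn].
  + rewrite pos_part_nonneg by exact Hp.
    specialize (Hd x Hx Hxd); rewrite Rplus_0_l in Hd; exact Hd.
  + rewrite pos_part_nonpos, H0 by lra.
    replace ((h 0 - h 0) / x - 0) with 0 by (field; exact Hx).
    rewrite Rabs_R0; exact Heps.
Qed.

Lemma is_derive_shift_arg (h : R -> R) (t c l : R) :
  is_derive h (t - c) l -> is_derive (fun x => h (x - c)) t l.
Proof.
intro Hh; replace l with (scal 1 l) by (apply Rmult_1_l).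
apply (is_derive_comp h (fun x => x - c)); [exact Hh|].
auto_derive; [exact I | ring].
Qed.

Definition delay_sum (b tau : R) (N : nat) (u : nat -> R -> R) (t : R) : R :=
  sum_n (fun k => b ^ k * u k (pos_part (t - INR k * tau))) N.

Lemma continuous_delay_sum (b tau : R) (N : nat) (u : nat -> R -> R) (t : R) :
  (forall k x, continuous (u k) x) -> continuous (delay_sum b tau N u) t.
Proof.
intro Hu.
assert (Hk : forall k,
  continuous (fun x => b ^ k * u k (pos_part (x - INR k * tau))) t).
{ intro k; apply (continuous_scal_r (b ^ k)
                    (fun x => u k (pos_part (x - INR k * tau)))).
  apply (continuous_comp (fun x => pos_part (x - INR k * tau)) (u k)); [|apply Hu].
  apply (continuous_comp (fun x => x - INR k * tau) pos_part);
    [|apply continuous_pos_part].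
  apply (ex_derive_continuous (fun x => x - INR k * tau)); auto_derive; exact I. }
unfold delay_sum; induction N as [|N IH].
- apply (continuous_ext (fun x => b ^ 0 * u 0%nat (pos_part (x - INR 0 * tau))));
    [intro; rewrite sum_O; reflexivity | apply Hk].
- apply (continuous_ext (fun x =>
    plus (sum_n (fun k => b ^ k * u k (pos_part (x - INR k * tau))) N)
         (b ^ S N * u (S N) (pos_part (x - INR (S N) * tau)))));
    [intro; rewrite sum_Sn; reflexivity|].
  apply (continuous_plus (V := R_NormedModule)); [exact IH | apply Hk].
Qed.

(** The alternative in the second hypothesis serves the second derivative of the
solution, where du 0 0 = F(0) need not vanish but only t > 0 matters. *)
Lemma is_derive_delay_sum (b tau : R) (N : nat) (u du : nat -> R -> R) (t : R) :
  (forall k x, is_derive (u k) x (du k x)) ->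
  (forall k, du k 0 = 0 \/ 0 < t - INR k * tau) ->
  is_derive (delay_sum b tau N u) t (delay_sum b tau N du t).
Proof.
intros Hu H0.
apply (is_derive_sum_n (fun k x => b ^ k * u k (pos_part (x - INR k * tau)))).
intros k _; apply is_derive_scal.
apply (is_derive_shift_arg (fun x => u k (pos_part x))).
apply is_derive_comp_pos_part; [apply Hu | apply H0].
Qed.

Lemma delay_sum_nonpos (b tau : R) (N : nat) (u : nat -> R -> R) (t : R) :
  0 < tau -> (forall k, u k 0 = 0) -> t <= 0 -> delay_sum b tau N u t = 0.
Proof.
intros Htau u0 Ht; unfold delay_sum.
rewrite (sum_n_ext _ (fun _ => 0)).
- rewrite sum_n_const; apply Rmult_0_r.
- intro k; rewrite pos_part_nonpos, u0; [apply Rmult_0_r|].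
  assert (0 <= INR k * tau) by (apply Rmult_le_pos; [apply pos_INR | lra]); lra.
Qed.

(** The lowering k |-> k - 1 costs a factor b; the last term is the one that has no
successor in the finite sum. *)
Lemma sum_n_shift (b : R) (w : nat -> R) (n : nat) :
  sum_n (fun k => b ^ k * shift w k) n + b ^ S n * w n =
  b * sum_n (fun k => b ^ k * w k) n.
Proof.
induction n as [|n IH].
- rewrite !sum_O; simpl; ring.
- rewrite !sum_Sn; change (plus ?x ?y) with (x + y).
  unfold shift at 2; rewrite IH; simpl pow; ring.
Qed.

(** Lowering the mode index by one while keeping the argument t - k tau amounts to
replacing t by t - tau; this is how the delayed term b y(t - tau) arises.  For
t - tau <= N tau the truncation of the sum at k = N loses nothing. *)
Lemma delay_sum_recurrence (a b tau : R) (N : nat) (u : nat -> R -> R)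
    (phi : R -> R) (t : R) :
  (forall k, u k 0 = 0) -> t - tau <= INR N * tau ->
  delay_sum b tau N
    (fun k x => a * u k x + shift (fun i => u i x) k
                + match k with O => phi x | S _ => 0 end) t =
  a * delay_sum b tau N u t + b * delay_sum b tau N u (t - tau)
  + phi (pos_part t).
Proof.
intros u0 Ht.
set (w := fun i => u i (pos_part (t - tau - INR i * tau))).
assert (Hw : w N = 0) by (unfold w; rewrite pos_part_nonpos by lra; apply u0).
unfold delay_sum; fold w.
change (sum_n (fun k => b ^ k * u k (pos_part (t - tau - INR k * tau))) N)
  with (sum_n (fun k => b ^ k * w k) N).
rewrite <- sum_n_shift, Hw, Rmult_0_r, Rplus_0_r.
assert (Hs : forall k, shift (fun i => u i (pos_part (t - INR k * tau))) k = shift w k).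
{ intros [|k]; [reflexivity|]; unfold shift, w; rewrite S_INR.
  do 2 f_equal; ring. }
clear Hw; clearbody w; clear Ht; induction N as [|N IH].
- rewrite !sum_O, Hs; simpl; rewrite Rmult_0_l, Rminus_0_r; ring.
- rewrite !sum_Sn; change (plus ?x ?y) with (x + y).
  rewrite IH, Hs; ring.
Qed.

(** * The convolution formula *)

(** The integrand vanishes for s beyond (t - d)_+, because g(0) = 0. *)
Lemma is_RInt_pos_part_conv (g F : R -> R) (d t : R) :
  (forall x, continuous g x) -> (forall x, continuous F x) -> g 0 = 0 ->
  0 <= d -> 0 <= t ->
  is_RInt (fun s => g (pos_part (t - s - d)) * F s) 0 t
    (conv g F (pos_part (t - d))).
Proof.
intros Hg HF g0 Hd Ht.
set (c := pos_part (t - d)).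
assert (Hc : 0 <= c <= t).
{ unfold c, pos_part; split; [apply Rmax_l | apply Rmax_lub; lra]. }
rewrite <- (Rplus_0_r (conv g F c)).
apply (is_RInt_Chasles (V := R_NormedModule) _ 0 c t).
- apply (is_RInt_ext (fun s => g (c - s) * F s)).
  + rewrite Rmin_left, Rmax_right by lra; intros s Hs.
    assert (Hcd : c = t - d).
    { unfold c in *; apply pos_part_nonneg.
      destruct (Rle_dec 0 (t - d)); [assumption|].
      rewrite pos_part_nonpos in Hs by lra; lra. }
    replace (pos_part (t - s - d)) with (c - s); [reflexivity|].
    rewrite pos_part_nonneg; lra.
  + apply (RInt_correct (V := R_CompleteNormedModule)), ex_RInt_conv; assumption.
- apply (is_RInt_ext (fun _ => 0)); [|apply is_RInt_zero].
  rewrite Rmin_left, Rmax_right by lra; intros s Hs.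
  rewrite pos_part_nonpos, g0; [symmetry; apply Rmult_0_l|].
  pose proof (Rmax_r 0 (t - d)) as Hm; fold (pos_part (t - d)) in Hm.
  unfold c in Hs; lra.
Qed.

Lemma is_RInt_sum_n (u : nat -> R -> R) (l : nat -> R) (x y : R) (n : nat) :
  (forall k, is_RInt (u k) x y (l k)) ->
  is_RInt (fun s => sum_n (fun k => u k s) n) x y (sum_n l n).
Proof.
intro Hu; induction n as [|n IH].
- rewrite sum_O; apply (is_RInt_ext (u 0%nat)); [|apply Hu].
  intros s _; rewrite sum_O; reflexivity.
- rewrite sum_Sn.
  apply (is_RInt_ext (fun s => plus (sum_n (fun k => u k s) n) (u (S n) s))).
  + intros s _; rewrite sum_Sn; reflexivity.
  + apply (is_RInt_plus (V := R_NormedModule)); [exact IH | apply Hu].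
Qed.

Lemma is_RInt_dpf_conv (a b tau : R) (N : nat) (F : R -> R) (t : R) :
  0 < tau -> (forall x, continuous F x) -> 0 <= t <= INR N * tau ->
  is_RInt (fun s => dpf a b tau (t - s) * F s) 0 t
    (delay_sum b tau N (fun k => conv (mode a k) F) t).
Proof.
intros Htau HF Ht.
apply (is_RInt_ext (fun s => sum_n (fun k =>
  scal (b ^ k) (mode a k (pos_part (t - s - INR k * tau)) * F s)) N)).
- rewrite Rmin_left, Rmax_right by lra; intros s Hs.
  rewrite (dpf_modes _ _ _ _ N) by lra.
  rewrite <- (sum_n_mult_r (K := R_Ring)).
  apply sum_n_ext; intro k; symmetry; apply Rmult_assoc.
- apply (is_RInt_sum_n _ (fun k =>
    b ^ k * conv (mode a k) F (pos_part (t - INR k * tau)))).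
  intro k; apply (is_RInt_scal (V := R_NormedModule)).
  apply is_RInt_pos_part_conv; try lra; [apply continuous_mode | exact HF | apply mode_0 |].
  apply Rmult_le_pos; [apply pos_INR | lra].
Qed.

(** * Derivatives along an interval and continuous extension *)

(** Composition with the projection onto [l, u] extends a function continuous on
[l, u] to a function continuous on the line, so that two-sided notions apply. *)
Definition clamp (l u t : R) : R := Rmax l (Rmin u t).

Lemma clamp_id (l u t : R) : l <= t <= u -> clamp l u t = t.
Proof. intros []; unfold clamp; rewrite Rmin_right, Rmax_right; lra. Qed.

Lemma clamp_in (l u t : R) : l <= u -> l <= clamp l u t <= u.
Proof.
intro H; unfold clamp; split; [apply Rmax_l|].
apply Rmax_lub; [exact H | apply Rmin_l].
Qed.

Lemma clamp_dist (l u x t : R) : Rabs (clamp l u x - clamp l u t) <= Rabs (x - t).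
Proof.
unfold clamp, Rmax, Rmin.
repeat destruct Rle_dec; unfold Rabs; repeat destruct Rcase_abs; lra.
Qed.

Lemma continuous_clamp (g : R -> R) (l u : R) :
  l <= u -> continuous_on (Icc l u) g ->
  forall t, continuous (fun x => g (clamp l u x)) t.
Proof.
intros Hlu Hg t.
apply (filterlim_comp _ _ _ (clamp l u) g _
         (within (Icc l u) (locally (clamp l u t)))).
2: apply Hg, clamp_in, Hlu.
intros P [d Hd]; exists d; intros x Hx.
apply Hd; [|apply clamp_in, Hlu].
apply Rle_lt_trans with (1 := clamp_dist l u x t); exact Hx.
Qed.

Lemma D_in_is_derive (y dy : R -> R) (D : R -> Prop) (t : R) :
  is_derive y t (dy t) -> D_in y dy D t.
Proof.
intro H; apply is_derive_Reals in H.
intros eps Heps; destruct (H eps Heps) as [d Hd].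
exists d; split; [apply d|].
intros x [[_ Hne] Hx]; simpl in Hx |- *; unfold R_dist in *.
specialize (Hd (x - t)); rewrite Rplus_minus in Hd.
apply Hd; [lra | exact Hx].
Qed.

Lemma is_derive_D_in (y dy : R -> R) (l u t : R) :
  l < t < u -> D_in y dy (Icc l u) t -> is_derive y t (dy t).
Proof.
intros Ht H; apply is_derive_Reals; intros eps Heps.
destruct (H eps Heps) as [d [Hd0 Hd]].
assert (Hm : 0 < Rmin d (Rmin (t - l) (u - t)))
  by (repeat apply Rmin_pos; lra).
exists (mkposreal _ Hm); intros h Hh0 Hh; simpl in Hh.
assert (Hh1 := Rlt_le_trans _ _ _ Hh (Rmin_l _ _)).
assert (Hh2 := Rlt_le_trans _ _ _ Hh (Rmin_r _ _)).
assert (Hh3 := Rlt_le_trans _ _ _ Hh2 (Rmin_l _ _)).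
assert (Hh4 := Rlt_le_trans _ _ _ Hh2 (Rmin_r _ _)).
apply Rabs_def2 in Hh3; apply Rabs_def2 in Hh4.
specialize (Hd (t + h)); simpl in Hd; unfold R_dist in Hd.
replace (t + h - t) with h in Hd by ring.
apply Hd; split; [|exact Hh1].
split; [unfold Icc; lra | lra].
Qed.

(** Every point of a nondegenerate interval is a limit of other points of it. *)
Lemma D_in_Icc_unique (y d1 d2 : R -> R) (l u t : R) :
  l < u -> l <= t <= u ->
  D_in y d1 (Icc l u) t -> D_in y d2 (Icc l u) t -> d1 t = d2 t.
Proof.
intros Hlu Ht H1 H2.
refine (single_limit _ _ _ _ _ _ H1 H2).
intros alp Halp; unfold D_x, Icc, Rdist.
destruct (Rle_lt_dec u t).
- exists (t - Rmin (alp / 2) (u - l)).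
  assert (0 < Rmin (alp / 2) (u - l)) by (apply Rmin_pos; lra).
  assert (Rmin (alp / 2) (u - l) <= alp / 2) by apply Rmin_l.
  assert (Rmin (alp / 2) (u - l) <= u - l) by apply Rmin_r.
  repeat split; try lra; apply Rabs_def1; lra.
- exists (t + Rmin (alp / 2) (u - t)).
  assert (0 < Rmin (alp / 2) (u - t)) by (apply Rmin_pos; lra).
  assert (Rmin (alp / 2) (u - t) <= alp / 2) by apply Rmin_l.
  assert (Rmin (alp / 2) (u - t) <= u - t) by apply Rmin_r.
  repeat split; try lra; apply Rabs_def1; lra.
Qed.

(** * Existence *)

Lemma stepwise_solution_delay_sum (a b tau : R) (N : nat) (f F : R -> R) :
  0 < tau -> (forall x, continuous F x) ->
  (forall t, 0 <= t <= INR N * tau -> F t = f t) ->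
  stepwise_solution a b tau N f (fun _ => 0)
    (delay_sum b tau N (fun k => conv (mode a k) F)).
Proof.
intros Htau HF HFf.
set (y := delay_sum b tau N (fun k => conv (mode a k) F)).
set (dy := delay_sum b tau N (fun k => conv (dmode a k) F)).
set (ddy := fun t => a * y t + b * y (t - tau) + F t).
assert (Dy : forall t, is_derive y t (dy t)).
{ intro t; apply is_derive_delay_sum.
  - intros k x; apply is_derive_conv_mode, HF.
  - intro k; left; apply conv_0. }
assert (Cy : forall t, continuous y t)
  by (intro t; apply (ex_derive_continuous y); eexists; apply Dy).
assert (Cdy : forall t, continuous dy t).
{ intro t; apply continuous_delay_sum; intros k x.
  apply (ex_derive_continuous (conv (dmode a k) F)).
  eexists; apply is_derive_conv_dmode, HF. }
assert (Cddy : forall t, continuous ddy t).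
{ intro t; apply (continuous_plus (fun t => a * y t + b * y (t - tau)) F);
    [|apply HF].
  apply (continuous_plus (fun t => a * y t) (fun t => b * y (t - tau))).
  - apply (continuous_scal_r a y), Cy.
  - apply (continuous_scal_r b (fun t => y (t - tau))).
    apply (continuous_comp (fun t => t - tau) y); [|apply Cy].
    apply (ex_derive_continuous (fun t => t - tau)); auto_derive; exact I. }
assert (Ddy : forall t, 0 < t <= INR N * tau -> is_derive dy t (ddy t)).
{ intros t Ht; unfold ddy, y.
  rewrite <- (pos_part_nonneg t) at 4 by lra.
  rewrite <- (delay_sum_recurrence a b tau N (fun k => conv (mode a k) F));
    [|intro; apply conv_0 | lra].
  apply is_derive_delay_sum.
  - intros k x; apply is_derive_conv_dmode, HF.
  (* For k >= 1 the second derivative a H_k + H_(k-1) vanishes at 0. *)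
  - intros [|k]; [right; simpl; lra | left].
    rewrite !conv_0; simpl; rewrite conv_0; ring. }
exists dy, ddy; split; [|split].
- split; [|split].
  + apply continuous_on_forall; intros; apply Cy.
  + intros; apply D_in_is_derive, Dy.
  + apply continuous_on_forall; intros; apply Cdy.
- intros k Hk l u.
  assert (Hlu : forall t, Ioo l u t -> 0 < t <= INR N * tau).
  { intros t [Hl Hu].
    assert (0 <= l).
    { apply Rmult_le_pos; [|lra].
      pose proof (le_INR 1 k ltac:(lia)) as H1; simpl in H1; lra. }
    assert (u <= INR N * tau)
      by (apply Rmult_le_compat_r; [lra | apply le_INR; lia]).
    lra. }
  split; [|split; [|split]].
  + intros t Ht; apply Ddy, Hlu, Ht.
  + apply continuous_on_forall; intros; apply Cddy.
  + exists ddy; split; [|reflexivity].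
    apply continuous_on_forall; intros; apply Cddy.
  + intros t Ht; apply Hlu in Ht; unfold ddy; rewrite HFf by lra; reflexivity.
- intros t [_ Ht]; split.
  + apply delay_sum_nonpos; [exact Htau | intro; apply conv_0 | exact Ht].
  + assert (H0 : dy t = 0)
      by (apply delay_sum_nonpos; [exact Htau | intro; apply conv_0 | exact Ht]).
    apply D_in_is_derive; rewrite H0.
    apply (is_derive_const (V := R_NormedModule)).
Qed.

(** * Uniqueness by the method of steps *)

(** With E = z^2 + z'^2 one has E' = 2 (1 + c) z z' <= (1 + |c|) E, so the weighted
energy E(s) exp(- (1 + |c|) (s - l)) is nonincreasing; it starts at 0 and is
nonnegative. *)
Lemma linear_ode2_zero (c l u : R) (z dz : R -> R) :
  (forall t, l < t < u -> is_derive z t (dz t)) ->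
  (forall t, l < t < u -> is_derive dz t (c * z t)) ->
  (forall t, continuous z t) -> (forall t, continuous dz t) ->
  z l = 0 -> dz l = 0 ->
  forall t, l <= t <= u -> z t = 0 /\ dz t = 0.
Proof.
intros Hz Hdz Cz Cdz z0 dz0 t Ht.
set (w := fun s => (z s * z s + dz s * dz s) * exp (- (1 + Rabs c) * (s - l))).
set (dw := fun s => (2 * (1 + c) * (z s * dz s)
                     - (1 + Rabs c) * (z s * z s + dz s * dz s))
                    * exp (- (1 + Rabs c) * (s - l))).
destruct (MVT_gen w l t dw) as [s [_ Hs]].
- rewrite Rmin_left, Rmax_right by lra; intros s Hs.
  assert (H1 := Hz s ltac:(lra)); assert (H2 := Hdz s ltac:(lra)).
  unfold w, dw; auto_derive.
  + repeat split; eexists; eassumption.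
  + rewrite (is_derive_unique (fun x : R => z x) _ _ H1),
      (is_derive_unique (fun x : R => dz x) _ _ H2).
    unfold Rminus; ring.
- intros s _; apply continuity_pt_filterlim; unfold w.
  apply (continuous_mult (fun s => z s * z s + dz s * dz s)
           (fun s => exp (- (1 + Rabs c) * (s - l)))).
  + apply (continuous_plus (fun s => z s * z s) (fun s => dz s * dz s)).
    * apply (continuous_mult z z); apply Cz.
    * apply (continuous_mult dz dz); apply Cdz.
  + apply (ex_derive_continuous (fun s => exp (- (1 + Rabs c) * (s - l)))).
    auto_derive; exact I.
- assert (Hw : w t <= 0).
  { replace (w t) with (dw s * (t - l))
      by (rewrite <- Hs; unfold w; rewrite z0, dz0; ring).
    enough (Hd : dw s <= 0)
      by (pose proof (Rmult_le_pos (- dw s) (t - l)); lra).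
    assert (H1 : Rabs (1 + c) <= 1 + Rabs c).
    { rewrite <- Rabs_R1 at 2; apply Rabs_triang. }
    assert (H2 : 2 * Rabs (z s * dz s) <= z s * z s + dz s * dz s).
    { unfold Rabs; destruct Rcase_abs;
        [pose proof (Rle_0_sqr (z s + dz s)) as Hq
        |pose proof (Rle_0_sqr (z s - dz s)) as Hq]; unfold Rsqr in Hq; lra. }
    assert (H3 := Rle_abs ((1 + c) * (z s * dz s))).
    rewrite Rabs_mult in H3.
    assert (H4 := Rmult_le_compat _ _ _ _ (Rabs_pos _) 
                    (Rmult_le_pos 2 _ ltac:(lra) (Rabs_pos (z s * dz s))) H1 H2).
    assert (He := exp_pos (- (1 + Rabs c) * (s - l))).
    unfold dw; set (p := 2 * (1 + c) * _ - _).
    assert (Hp : 0 <= - p) by (unfold p; lra).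
    pose proof (Rmult_le_pos _ _ Hp (Rlt_le _ _ He)); lra. }
  assert (He := exp_pos (- (1 + Rabs c) * (t - l))).
  assert (Hq1 := Rle_0_sqr (z t)); assert (Hq2 := Rle_0_sqr (dz t)).
  unfold Rsqr in Hq1, Hq2.
  assert (Hs0 : z t * z t + dz t * dz t <= 0).
  { apply Rnot_lt_le; intro Hp; unfold w in Hw.
    pose proof (Rmult_lt_0_compat _ _ Hp He); lra. }
  split; apply Rsqr_0_uniq; unfold Rsqr; lra.
Qed.

(** Method of steps.  The difference is clamped to [- tau, N tau], because continuity
of solutions is known only along that interval. *)
Lemma stepwise_solution_unique (a b tau : R) (N : nat) (f phi y1 y2 : R -> R) :
  0 < tau ->
  stepwise_solution a b tau N f phi y1 -> stepwise_solution a b tau N f phi y2 ->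
  forall t, Icc (- tau) (INR N * tau) t -> y1 t = y2 t.
Proof.
intros Htau [dy1 [ddy1 [[Cy1 [Dy1 Cdy1]] [E1 I1]]]]
            [dy2 [ddy2 [[Cy2 [Dy2 Cdy2]] [E2 I2]]]].
set (T := INR N * tau) in *.
assert (HT : 0 <= T) by (apply Rmult_le_pos; [apply pos_INR | lra]).
set (cl := clamp (- tau) T).
set (z := fun x => y1 (cl x) - y2 (cl x)).
set (dz := fun x => dy1 (cl x) - dy2 (cl x)).
assert (Hcl : forall x, - tau <= x <= T -> cl x = x) by (apply clamp_id).
assert (Cz : forall x, continuous z x).
{ intro x; apply (continuous_minus (fun x => y1 (cl x)) (fun x => y2 (cl x)));
    apply continuous_clamp; (lra || assumption). }
assert (Cdz : forall x, continuous dz x).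
{ intro x; apply (continuous_minus (fun x => dy1 (cl x)) (fun x => dy2 (cl x)));
    apply continuous_clamp; (lra || assumption). }
assert (Hloc : forall (g1 g2 : R -> R) (x l1 l2 : R), - tau < x < T ->
  is_derive g1 x l1 -> is_derive g2 x l2 ->
  is_derive (fun s => g1 (cl s) - g2 (cl s)) x (l1 - l2)).
{ intros g1 g2 x l1 l2 Hx H1 H2.
  apply (is_derive_ext_loc (fun s => g1 s - g2 s)).
  - apply (filter_imp (fun s => - tau < s /\ s < T)).
    + intros s Hs; rewrite Hcl by lra; reflexivity.
    + apply filter_and; [apply (open_gt (- tau)) | apply (open_lt T)]; apply Hx.
  - apply (is_derive_minus (V := R_NormedModule)); assumption. }
enough (H : forall k, (k <= N)%nat ->
  forall t, - tau <= t <= INR k * tau -> z t = 0 /\ dz t = 0).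
{ intros t Ht; destruct (H N (Nat.le_refl N) t Ht) as [Hz _].
  unfold z in Hz; rewrite Hcl in Hz by exact Ht; lra. }
induction k as [|k IH]; intros Hk t Ht.
- simpl in Ht; rewrite Rmult_0_l in Ht.
  unfold z, dz; rewrite Hcl by lra.
  destruct (I1 t Ht) as [-> J1]; destruct (I2 t Ht) as [-> J2].
  rewrite (D_in_Icc_unique phi dy1 dy2 (- tau) 0 t) by (lra || assumption); lra.
- specialize (IH ltac:(lia)).
  destruct (Rle_dec t (INR k * tau)) as [Hle|Hgt]; [apply IH; lra|].
  assert (Hk0 : 0 <= INR k * tau) by (apply Rmult_le_pos; [apply pos_INR | lra]).
  assert (HkT : INR (S k) * tau <= T)
    by (apply Rmult_le_compat_r; [lra | apply le_INR; exact Hk]).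
  destruct (E1 (S k) ltac:(lia)) as [F1 [_ [_ G1]]].
  destruct (E2 (S k) ltac:(lia)) as [F2 [_ [_ G2]]].
  assert (Hl : (INR (S k) - 1) * tau = INR k * tau) by (rewrite S_INR; ring).
  assert (Hu : INR (S k) * tau = INR k * tau + tau) by (rewrite S_INR; ring).
  rewrite Hl in *.
  destruct (IH (INR k * tau)) as [z0 dz0]; [lra|].
  apply (linear_ode2_zero a (INR k * tau) (INR (S k) * tau));
    try assumption; try lra.
  + intros x Hx; unfold dz; rewrite Hcl by lra.
    apply Hloc; [lra | |]; apply (is_derive_D_in _ _ (- tau) T);
      (lra || (apply Dy1 || apply Dy2); unfold Icc; lra).
  + intros x Hx; replace (a * z x) with (ddy1 x - ddy2 x).
    { apply Hloc; [lra | apply F1, Hx | apply F2, Hx]. }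
    rewrite G1, G2 by exact Hx.
    destruct (IH (x - tau)) as [Hd _]; [lra|].
    unfold z in Hd |- *; rewrite Hcl in Hd by lra; rewrite Hcl by lra.
    replace (y1 (x - tau)) with (y2 (x - tau)) by lra; ring.
Qed.

Theorem theorem3 (a b tau T : R) (N : nat) (f : R -> R)
    (htau : 0 < tau) (hN : (1 <= N)%nat) (hT : T = INR N * tau)
    (hf : continuous_on (Icc 0 T) f) :
  exists yp : R -> R,
    stepwise_solution a b tau N f (fun _ => 0) yp /\
    (forall y : R -> R, stepwise_solution a b tau N f (fun _ => 0) y ->
       forall t, Icc (- tau) T t -> y t = yp t) /\
    (forall t, Icc 0 T t ->
       is_RInt (fun s => dpf a b tau (t - s) * f s) 0 t (yp t)).
Proof.
subst T.
assert (HT : 0 <= INR N * tau) by (apply Rmult_le_pos; [apply pos_INR | lra]).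
set (F := fun t => f (clamp 0 (INR N * tau) t)).
assert (HF : forall t, continuous F t) by (apply continuous_clamp; assumption).
assert (HFf : forall t, 0 <= t <= INR N * tau -> F t = f t)
  by (intros t Ht; unfold F; rewrite clamp_id by exact Ht; reflexivity).
assert (Hsol := stepwise_solution_delay_sum a b tau N f F htau HF HFf).
eexists; split; [exact Hsol | split].
- intros y Hy; apply (stepwise_solution_unique a b tau N f (fun _ => 0));
    assumption.
- intros t Ht.
  apply (is_RInt_ext (fun s => dpf a b tau (t - s) * F s)).
  + unfold Icc in Ht; rewrite Rmin_left, Rmax_right by lra; intros s Hs.
    rewrite HFf by lra; reflexivity.
  + apply is_RInt_dpf_conv; assumption.
Qed.
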